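(* Let $\ell$ be a positive integer with $\ell\le 4$. Then there exists no graph $G$ with an edge $e\in E(G)$ such that $\gamma_g(G)=\ell$ and $\gamma_g(G-e)=\ell-2$.
   Context: Graphs are finite, simple and undirected. A vertex dominates itself and all its neighbors. The domination game on a graph $G$ is played by two players, Dominator and Staller, who alternately choose a vertex of $G$ such that each chosen vertex dominates at least one vertex that was not dominated by the previously chosen vertices. The game ends when all vertices of $G$ are dominated. Dominator wants the total number of chosen vertices to be as small as possible, Staller wants it to be as large as possible. Assuming both play optimally, $\gamma_g(G)$ (the game domination number) is the total number of vertices chosen when Dominator moves first. $G-e$ denotes the graph obtained from $G$ by removing the edge $e$ (keeping all vertices). *)

(* Defs.v *)
From mathcomp Require Import all_boot.
Set Implicit Arguments.
Unset Strict Implicit.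
Unset Printing Implicit Defensive.

Record sgraph := SGraph {
  vertex :> finType;
  adj : rel vertex;
  adj_sym : symmetric adj;
  adj_irrefl : irreflexive adj }.

Definition edges (G : sgraph) : {set {set G}} :=
  [set e : {set G} | [exists x, exists y, adj x y && (e == [set x; y])]].

Definition del_edge_adj (G : sgraph) (e : {set G}) : rel G :=
  [rel x y | adj x y && ([set x; y] != e)].

Lemma del_edge_sym (G : sgraph) (e : {set G}) : symmetric (del_edge_adj e).
Proof. by move=> x y; rewrite /del_edge_adj /= adj_sym setUC. Qed.

Lemma del_edge_irrefl (G : sgraph) (e : {set G}) :
  irreflexive (del_edge_adj e).
Proof. by move=> x; rewrite /del_edge_adj /= adj_irrefl. Qed.

Definition del_edge (G : sgraph) (e : {set G}) : sgraph :=
  SGraph (@del_edge_sym G e) (@del_edge_irrefl G e).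

Definition cnbhd (G : sgraph) (v : G) : {set G} :=
  [set w | (w == v) || adj v w].

(* A position of the game is the set D of vertices dominated so far: legality
   of moves and the end of the game depend on the chosen vertices only
   through D. *)
Definition legal (G : sgraph) (D : {set G}) (v : G) : bool :=
  ~~ (cnbhd v \subset D).

Inductive player := Dominator | Staller.

(* Minimax value: the number of further moves, under optimal play, from
   position D with p to move. The argument n only makes the recursion
   structural; by moves_fuel any n >= #|~: D| gives the same value. While D is
   not everything a legal move exists (legal_exists), and every value is at
   most #|G| (moves_bound, max_card), so the default #|G| of the minimum over
   legal moves is harmless. *)
Fixpoint moves_rec (G : sgraph) (n : nat) (p : player) (D : {set G}) : nat :=
  if n is n'.+1 then
    if D == setT then 0
    else match p with
         | Dominator =>
             (\big[minn/#|G|]_(v | legal D v)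
                moves_rec n' Staller (D :|: cnbhd v)).+1
         | Staller =>
             (\max_(v | legal D v)
                moves_rec n' Dominator (D :|: cnbhd v)).+1
         end
  else 0.

Definition moves (G : sgraph) (p : player) (D : {set G}) : nat :=
  moves_rec #|G| p D.

Definition gamma_g (G : sgraph) : nat := moves Dominator (set0 : {set G}).

Lemma legal_exists (G : sgraph) (D : {set G}) :
  D != setT -> exists v, legal D v.
Proof.
rewrite -subTset => /subsetPn[v _ vD]; exists v.
by apply/subsetPn; exists v; rewrite ?inE ?eqxx.
Qed.

Lemma legal_decr (G : sgraph) (D : {set G}) (v : G) :
  legal D v -> #|~: (D :|: cnbhd v)| < #|~: D|.
Proof.
case/subsetPn=> w wv wD; apply: proper_card.
apply/properP; split; first by rewrite setCS subsetUl.
by exists w; rewrite in_setC // in_setU wv orbT.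
Qed.

Lemma moves_fuel (G : sgraph) (n m : nat) (p : player) (D : {set G}) :
  #|~: D| <= n -> #|~: D| <= m -> moves_rec n p D = moves_rec m p D.
Proof.
have full q (E : {set G}) k : #|~: E| <= 0 -> moves_rec k q E = 0.
  rewrite leqn0 cards_eq0 => /eqP EC; case: k => //= k.
  by rewrite -[E]setCK EC setC0 eqxx.
elim: n m p D => [|n IHn] m p D Dn Dm; first by rewrite (full _ _ m).
case: m Dm => [|m] Dm; first by rewrite (full _ _ n.+1).
rewrite /=; case: ifP => // _.
have step v q : legal D v ->
    moves_rec n q (D :|: cnbhd v) = moves_rec m q (D :|: cnbhd v).
  by move/legal_decr => Dv; apply: IHn; rewrite -ltnS (leq_trans Dv).
by case: p; congr _.+1; apply: eq_bigr => v /step.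
Qed.

Lemma moves_end (G : sgraph) (p : player) : moves p [set: G] = 0.
Proof. by rewrite /moves; case: #|G| => //= n; rewrite eqxx. Qed.

Lemma moves_step (G : sgraph) (p : player) (D : {set G}) :
  D != setT ->
  moves p D =
    match p with
    | Dominator =>
        (\big[minn/#|G|]_(v | legal D v) moves Staller (D :|: cnbhd v)).+1
    | Staller =>
        (\max_(v | legal D v) moves Dominator (D :|: cnbhd v)).+1
    end.
Proof.
move=> DT.
have -> : moves p D = moves_rec #|G|.+1 p D.
  by apply: moves_fuel; rewrite ?leqW ?max_card.
rewrite /= (negPf DT); by case: p.
Qed.

Lemma moves_bound (G : sgraph) (p : player) (D : {set G}) :
  moves p D <= #|~: D|.
Proof.
have [n] := ubnP #|~: D|; elim: n p D => // n IHn p D Dn.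
have [->|DT] := eqVneq D setT; first by rewrite moves_end.
have step v q : legal D v -> moves q (D :|: cnbhd v) < #|~: D|.
  move=> /legal_decr Dv; apply: leq_ltn_trans (Dv); apply: IHn.
  exact: leq_trans Dv _.
rewrite moves_step //; case: p; last first.
  have [v lv] := legal_exists DT.
  have D0 : 0 < #|~: D| by apply: leq_ltn_trans (legal_decr lv).
  rewrite -(prednK D0) ltnS; apply/bigmax_leqP => w lw.
  by rewrite -ltnS prednK // step.
have [v lv] := legal_exists DT.
apply: leq_ltn_trans (step v Staller lv).
have: v \in index_enum G by rewrite mem_index_enum.
elim: (index_enum G) => //= w s IHs; rewrite inE big_cons.
case/predU1P => [<-|/IHs le_v]; first by rewrite lv geq_minl.
by case: ifP => // _; rewrite geq_min le_v orbT.
Qed.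

(* Main.v *)
Require Import Defs.
From mathcomp Require Import all_boot all_order all_algebra.

Set Implicit Arguments.
Unset Strict Implicit.
Unset Printing Implicit Defensive.

(** If Dominator can finish [G - e] in two moves by starting with [v], then
    every reply of Staller inside the set [U] of vertices not dominated by [v]
    ends the game, so [U] is a clique of [G - e].  Both facts survive in [G]:
    after [v] and an arbitrary reply, any vertex still undominated lies in the
    clique [U], and playing it ends the game.  Hence [gamma_g G <= 3].  A
    universal vertex of [G - e] is universal in [G], which settles [l = 3]. *)

Lemma mem_cnbhd (G : sgraph) (v : G) : v \in cnbhd v.
Proof. by rewrite inE eqxx. Qed.

Lemma legal_notin (G : sgraph) (D : {set G}) (v : G) : v \notin D -> legal D v.
Proof. by move=> vD; apply/subsetPn; exists v; rewrite ?mem_cnbhd. Qed.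

Lemma moves_eq0 (G : sgraph) (p : player) (D : {set G}) :
  moves p D = 0 -> D = setT.
Proof. by apply: contra_eq => DT; rewrite moves_step //; case: p. Qed.

Lemma dominator_le (G : sgraph) (D : {set G}) (v : G) :
  legal D v -> moves Dominator D <= (moves Staller (D :|: cnbhd v)).+1.
Proof.
move=> lv; have [->|DT] := eqVneq D setT; first by rewrite moves_end.
rewrite moves_step // ltnS -minEnat -leEnat.
exact: Order.TotalTheory.bigmin_le_cond.
Qed.

Lemma dominator_best (G : sgraph) (D : {set G}) :
  D != setT ->
  exists2 v, legal D v
    & moves Dominator D = (moves Staller (D :|: cnbhd v)).+1.
Proof.
move=> DT; have [w lw] := legal_exists DT.
pose F v := moves Staller (D :|: cnbhd v).
(* The default [#|G|] is no smaller than any value [F v], so the minimum is attained at a legal move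
   and not only by the default. *)
have Fle v : legal D v -> (F v <= #|G|)%O.
  by rewrite leEnat => _; apply: leq_trans (moves_bound _ _) (max_card _).
rewrite moves_step // -minEnat (Order.TotalTheory.bigmin_eq_arg _ w) //.
by case: Order.TotalTheory.arg_minP => // v lv _; exists v.
Qed.

Lemma staller_gt (G : sgraph) (D : {set G}) (v : G) :
  legal D v -> moves Dominator (D :|: cnbhd v) < moves Staller D.
Proof.
move=> lv; have DT : D != setT.
  by apply: contraTneq lv => ->; rewrite /legal subsetT.
by rewrite [X in _ < X]moves_step // ltnS (leq_bigmax_cond v).
Qed.

Lemma staller_le (G : sgraph) (D : {set G}) (k : nat) :
  (forall v, legal D v -> moves Dominator (D :|: cnbhd v) <= k) ->
  moves Staller D <= k.+1.
Proof.
move=> le_k; have [->|DT] := eqVneq D setT; first by rewrite moves_end.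
by rewrite moves_step // ltnS; apply/bigmax_leqP.
Qed.

Lemma gamma_g_le (G : sgraph) (v : G) :
  gamma_g G <= (moves Staller (cnbhd v)).+1.
Proof.
by have := @dominator_le G set0 v; rewrite set0U; apply; rewrite legal_notin ?inE.
Qed.

Lemma gamma_g_best (G : sgraph) (x : G) :
  exists v : G, gamma_g G = (moves Staller (cnbhd v)).+1.
Proof.
have DT : set0 != [set: G] by rewrite eq_sym; apply/set0Pn; exists x.
by have [v _] := dominator_best DT; rewrite set0U; exists v.
Qed.

Lemma gamma_g_le1 (G : sgraph) (v : G) : cnbhd v = setT -> gamma_g G <= 1.
Proof. by move=> vT; have := gamma_g_le v; rewrite vT moves_end. Qed.

(** The hypothesis makes the vertices undominated by [v] a clique, so whatever Staller replies, any
    vertex still left finishes the game. *)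
Lemma gamma_g_le3 (G : sgraph) (v : G) :
  (forall u, u \notin cnbhd v -> cnbhd v :|: cnbhd u = setT) ->
  gamma_g G <= 3.
Proof.
move=> vuT; apply: leq_trans (gamma_g_le v) _; rewrite ltnS.
apply: staller_le => w _; set D := _ :|: _.
have [->|] := eqVneq D setT; first by rewrite moves_end.
rewrite -subTset => /subsetPn[u _ uD].
have uv : u \notin cnbhd v by apply: contra uD; rewrite in_setU => ->.
apply: leq_trans (dominator_le (legal_notin uD)) _.
(* The neighborhoods of [v] and [u] already cover everything; that of [w] is absorbed. *)
by rewrite /D setUAC vuT // setTU moves_end.
Qed.

Lemma cnbhd_del_edge (G : sgraph) (e : {set G}) (v : G) :
  @cnbhd (del_edge e) v \subset @cnbhd G v.
Proof.
by apply/subsetP => w; rewrite !inE /= => /orP[->|/andP[->]] //; rewrite orbT.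
Qed.

Theorem mainTheorem15 (l : nat) (l_gt0 : 0 < l) (l_le4 : l <= 4) :
  ~ exists (G : sgraph) (e : {set G}),
      [/\ e \in edges G,
          gamma_g G = l
        & ((gamma_g (del_edge e))%:Z = l%:Z - 2)%R].
Proof.
case=> G [e [eG gG gGe]].
(* An endpoint of [e] shows that the game is not over at the start, so an optimal first move [v]
   exists. *)
have [x _] : exists x : G, x \in G.
  by move: eG; rewrite inE => /existsP[x _]; exists x.
have [v gv] := @gamma_g_best (del_edge e) x; move: gGe; rewrite gv => gGe.
have sub w : @cnbhd (del_edge e) w \subset @cnbhd G w by apply: cnbhd_del_edge.
(* For [l] equal to 1 or 2, [l - 2] is not positive, whereas the game on [G - e] takes at least one
   move. Left are [l = 3] and [l = 4], where 0 and 1 moves remain after [v]. *)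
case: l l_gt0 l_le4 gG gGe => [|[|[|[|[|]]]]] //= _ _ gG [] stv.
- suff: gamma_g G <= 1 by rewrite gG.
  apply: (@gamma_g_le1 G v); apply/eqP; rewrite -subTset.
  by rewrite -(moves_eq0 stv) sub.
- suff: gamma_g G <= 3 by rewrite gG.
  apply: (@gamma_g_le3 G v) => u uv.
  have uv' : u \notin @cnbhd (del_edge e) v.
    by apply: contra uv; apply/subsetP.
  (* One move remains after [v] even for the best reply, so the reply [u] leaves none. *)
  have := @staller_gt (del_edge e) _ u (@legal_notin (del_edge e) _ u uv').
  rewrite stv ltnS leqn0.
  move=> /eqP /moves_eq0 vuT; apply/eqP; rewrite -subTset.
  by rewrite -vuT setUSS.
Qed.
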